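(* Let $E$ and $F$ be Banach spaces over the same field $\mathbb{K}$, where $\mathbb{K}=\mathbb{R}$ or $\mathbb{K}=\mathbb{C}$, let $m,n$ be positive integers, and let $P\in\mathcal{P}_a^s(^{n,\overset{m}{\ldots},n}E;F)$. Then for all $x_0,x_1,\ldots,x_m\in E$ we have $$P(x_1,\ldots,x_m)=\frac{1}{m!\,(n!\,2^n)^m}\sum_{\varepsilon_1,\ldots,\varepsilon_{mn}=\pm1}\varepsilon_1\cdots\varepsilon_{mn}\,P\Big(x_0+\sum_{k=1}^n\varepsilon_k x_1+\cdots+\sum_{k=1}^n\varepsilon_{(m-1)n+k}x_m\Big)^m-\frac{1}{m!\,2^{mn}}R_n(x_1,\ldots,x_m),$$ where $P(y)^m:=P(y,\ldots,y)$ ($m$ times) and $R_n:E^m\to F$ is the remainder function associated with $P$.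
   Context: A map $Q:E\to F$ is an $n$-homogeneous polynomial if there is an $n$-linear mapping $A:E^n\to F$ with $Q(x)=A(x,\ldots,x)$ for every $x\in E$ (no continuity required). $\mathcal{P}_a^s(^{n,\overset{m}{\ldots},n}E;F)$ is the vector space of all mappings $P:E^m\to F$ such that (i) for each $1\le j\le m$ and all fixed $x_i\in E$ ($i\neq j$) the mapping $P(x_1,\ldots,x_{j-1},\cdot,x_{j+1},\ldots,x_m):E\to F$ is an $n$-homogeneous polynomial, and (ii) $P$ is symmetric: $P(x_{\sigma(1)},\ldots,x_{\sigma(m)})=P(x_1,\ldots,x_m)$ for all $x_1,\ldots,x_m\in E$ and all permutations $\sigma$ of $\{1,\ldots,m\}$. Remainder function. Let $\mathcal{M}$ be the set of all $m\times(m+1)$ matrices $\alpha=(\alpha_{ij})$, $1\le i\le m$, $0\le j\le m$, with entries in $\mathbb{N}_0=\{0,1,2,\ldots\}$, whose $0$th column is zero and such that $\sum_{j=1}^m\alpha_{ij}=n$ for every $i\in\{1,\ldots,m\}$ and $\sum_{i=1}^m\alpha_{ij}=n$ for every $j\in\{1,\ldots,m\}$. Let $D$ be the set of those $\alpha\in\mathcal{M}$ such that for every $j\in\{1,\ldots,m\}$ there is $i\in\{1,\ldots,m\}$ with $\alpha_{ij}=n$. For a matrix $\alpha\in\mathcal{M}$ put $\alpha_i!:=\alpha_{i0}!\,\alpha_{i1}!\cdots\alpha_{im}!$ and, given signs $\varepsilon_1,\ldots,\varepsilon_{mn}\in\{1,-1\}$, $$\varepsilon_{i,j}:=\sum_{k=1}^{\alpha_{ij}}\varepsilon_{(i-1)n+(\alpha_{i0}+\cdots+\alpha_{i,j-1})+k}\qquad(1\le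 i,j\le m),$$ with $\varepsilon_{i,j}=0$ if $\alpha_{ij}=0$. Then $$R_n(x_1,\ldots,x_m):=\sum_{\alpha\in\mathcal{M}\setminus D}\ \sum_{\varepsilon_1,\ldots,\varepsilon_{mn}=\pm1}\frac{\varepsilon_1\cdots\varepsilon_{mn}}{\alpha_1!\cdots\alpha_m!}\,P\Big(\sum_{j=1}^m\varepsilon_{1,j}x_j,\ldots,\sum_{j=1}^m\varepsilon_{m,j}x_j\Big).$$ *)

(* Defs.v *)
From HB Require Import structures.
From mathcomp Require Import all_boot all_order all_fingroup all_algebra.
From mathcomp Require Import complex.
From mathcomp Require Import boolp classical_sets functions cardinality fsbigop.
From mathcomp Require Import reals topology normedtype.

Set Implicit Arguments.
Unset Strict Implicit.
Unset Printing Implicit Defensive.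

Import Order.TTheory GRing.Theory Num.Theory.
Local Open Scope classical_set_scope.
Local Open Scope ring_scope.

Variant scalar_kind := RealScalars | ComplexScalars.

Definition scalar_field (R : realType) (k : scalar_kind) : numFieldType :=
  match k with
  | RealScalars => R
  | ComplexScalars => R[i]
  end.

Section HomogeneousPolynomials.
Variables (K : numFieldType) (E F : lmodType K).

Definition multilinear n (A : ('I_n -> E) -> F) : Prop :=
  forall (x : 'I_n -> E) (j : 'I_n), linear (fun y => A [eta x with j |-> y]).

Definition homogeneous_polynomial n (Q : E -> F) : Prop :=
  exists2 A : ('I_n -> E) -> F, multilinear A & forall x, Q x = A (fun=> x).

Definition symmetric_multipolynomial n m (P : ('I_m -> E) -> F) : Prop :=
  (forall (x : 'I_m -> E) (j : 'I_m),
     homogeneous_polynomial n (fun y => P [eta x with j |-> y])) /\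
  (forall (x : 'I_m -> E) (s : 'S_m), P (fun i => x (s i)) = P x).

End HomogeneousPolynomials.

(* A matrix alpha has its columns indexed by 0, ..., m; the j-th of the columns
   1, ..., m is [lift ord0 j] with j : 'I_m. *)
Definition index_matrices n m : set 'M[nat]_(m, m.+1) :=
  [set alpha : 'M[nat]_(m, m.+1) |
    [/\ forall i, alpha i ord0 = 0%N,
        forall i, (\sum_(j < m) alpha i (lift ord0 j) = n)%N &
        forall j, (\sum_(i < m) alpha i (lift ord0 j) = n)%N]].
Arguments index_matrices : clear implicits.

Definition concentrated_matrices n m : set 'M[nat]_(m, m.+1) :=
  [set alpha : 'M[nat]_(m, m.+1) |
    index_matrices n m alpha /\ forall j : 'I_m, exists i, alpha i (lift ord0 j) = n].
Arguments concentrated_matrices : clear implicits.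

Definition row_fact m (alpha : 'M[nat]_(m, m.+1)) (i : 'I_m) : nat :=
  (\prod_(j < m.+1) (alpha i j)`!)%N.

Section Remainder.
Variables (K : numFieldType).

(* A choice of N signs is a boolean tuple of length N, [true] standing for -1;
   signs are numbered from 0. *)
Definition sgn N (eps : N.-tuple bool) (k : nat) : K :=
  (-1) ^+ nth false eps k.

Definition sgn_prod N (eps : N.-tuple bool) : K := \prod_(k < N) sgn eps k.

Definition block_sum n m (alpha : 'M[nat]_(m, m.+1))
    (eps : (m * n).-tuple bool) (i j : 'I_m) : K :=
  let c := lift ord0 j in
  \sum_(k < alpha i c)
     sgn eps (i * n + (\sum_(l < m.+1 | l < c) alpha i l) + k)%N.

Variables (E F : lmodType K).

Definition remainder n m (P : ('I_m -> E) -> F) (x : 'I_m -> E) : F :=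
  \sum_(alpha \in index_matrices n m `\` concentrated_matrices n m)
   \sum_(eps : (m * n).-tuple bool)
     (sgn_prod eps / (\prod_(i < m) row_fact alpha i)%N%:R) *:
       P (fun i => \sum_(j < m) block_sum alpha eps i j *: x j).

End Remainder.

(* The sum over \alpha in [remainder] is therefore not the default value of a
   sum with infinite support. *)
Lemma finite_index_matrices n m : finite_set (index_matrices n m).
Proof.
pose f (b : 'M['I_n.+1]_(m, m.+1)) : 'M[nat]_(m, m.+1) := map_mx val b.
apply: (@sub_finite_set _ _ (f @` setT)); last exact/finite_image/finite_finset.
move=> alpha [alpha0 row_sum _]; exists (map_mx inord alpha) => //.
apply/matrixP => i j; rewrite !mxE /= inordK // ltnS.
case: (unliftP ord0 j) => [k ->|->]; last by rewrite alpha0.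
by rewrite -[leqRHS](row_sum i) (bigD1 k) //= leq_addr.
Qed.

(* Main.v *)
(* Expand P on arguments that are linear combinations of x_0, ..., x_m:
     P(sum_j c_1j x_j, ..., sum_j c_mj x_j) = sum_b prod_ij c_ij^b_ij v_b,
   with b ranging over the exponent matrices whose rows sum to n.  Summing
   prod_k eps_k times a monomial of degree at most N in block sums of the N
   signs over all signs gives 0 unless each exponent is the size of its block.
   For the first sum this selects the b in M, each with coefficient
   (n! 2^n)^m; for the summand alpha of R_n, it selects b = alpha.  Hence the
   first sum minus the remainder leaves the v_b with b in D, that is, n times a
   permutation matrix, and there v_b = P(x_1, ..., x_m) by symmetry. *)
Require Import Defs.
From HB Require Import structures.
From mathcomp Require Import all_boot all_order all_fingroup all_algebra.
From mathcomp Require Import ring zify.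
From mathcomp Require Import complex.
From mathcomp Require Import boolp classical_sets functions cardinality fsbigop.
From mathcomp Require Import reals topology normedtype.

Set Implicit Arguments.
Unset Strict Implicit.
Unset Printing Implicit Defensive.

Import Order.TTheory GRing.Theory Num.Theory.
Local Open Scope ring_scope.

(** * Preliminaries on sums over tuples and of Booleans *)

Lemma big_tuple_cons (V : nmodType) (T : finType) N (F : N.+1.-tuple T -> V) :
  \sum_t F t = \sum_b \sum_(t : N.-tuple T) F [tuple of b :: t].
Proof.
rewrite pair_bigA (reindex (fun p : T * N.-tuple T => [tuple of p.1 :: p.2])) //.
exists (fun t => (thead t, [tuple of behead t])) => [[b t] _|t _] /=.
  by congr pair; apply: val_inj.
by rewrite [RHS]tuple_eta.
Qed.

Lemma sum_nat_pred1 N (b : 'I_N -> bool) (k0 : 'I_N) :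
  (forall k, b k = (k == k0)) -> (\sum_k b k = 1)%N.
Proof.
move=> bE; rewrite (bigD1 k0) //= bE eqxx big1 // => k.
by rewrite bE => /negPf->.
Qed.

(** * Sums over all signs of monomials in disjoint block sums *)

Section SignSums.
Variable K : numFieldType.

(** The terms of degree [d] in [u] cancel, so the sum stops at [d - 1]. This difference is what
    summing over a single sign makes of a power of a block sum. *)
Lemma exprD_subN (u : K) d :
  (1 + u) ^+ d - (-1 + u) ^+ d =
  \sum_(i < d) 'C(d, i)%:R * (1 - (-1) ^+ (d - i)) * u ^+ i.
Proof.
rewrite !exprDn -sumrB big_ord_recr /= subnn !expr0 !mul1r subrr addr0.
apply: eq_bigr => i _; rewrite expr1n mul1r -mulrnBl -mulr_natl; ring.
Qed.

Lemma sgn_prod_cons N b (t : N.-tuple bool) :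
  sgn_prod K [tuple of b :: t] = (-1) ^+ b * sgn_prod K t.
Proof. by rewrite /sgn_prod big_ord_recl. Qed.

(** Double counting: each position below [N] lies in exactly one cell. *)
Lemma sum_cells (J : finType) N (B : J -> nat -> bool) :
  (forall k, (k < N)%N -> exists j0, forall j, B j k = (j == j0)) ->
  (\sum_j \sum_(k < N) B j k = N)%N.
Proof.
move=> hB; rewrite exchange_big /= -[RHS]card_ord -sum1_card.
apply: eq_bigr => k _; have [j0 Bk] := hB k (ltn_ord k).
rewrite (bigD1 j0) //= Bk eqxx big1 // => j.
by rewrite Bk => /negPf->.
Qed.

(* [B j] is the j-th cell of a partition of the N sign positions.  Removing the
   first position, of cell a, replaces [u ^+ d a] by
   [(1 + u) ^+ d a - (-1 + u) ^+ d a], which has degree [d a - 1]. *)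
Lemma sum_signs (J : finType) N (B : J -> nat -> bool) (d : J -> nat) :
    (forall k, (k < N)%N -> exists j0, forall j, B j k = (j == j0)) ->
    (\sum_j d j <= N)%N ->
  \sum_(eps : N.-tuple bool)
     sgn_prod K eps * \prod_j (\sum_(k < N | B j k) sgn K eps k) ^+ d j
  = if [forall j, d j == \sum_(k < N) B j k]%N
    then 2 ^+ N * \prod_j (d j)`!%:R else 0.
Proof.
elim: N B d => [|N IHN] B d hB.
  rewrite leqn0 sum_nat_eq0 => /forallP/= d0.
  have {}d0 j : d j = 0%N by apply/eqP/d0.
  rewrite ifT; last by apply/forallP => j; rewrite d0 big_ord0.
  rewrite (big_pred1 [tuple]) => [|t]; last by rewrite [t]tuple0; apply/esym/eqP.
  rewrite expr0 mul1r /sgn_prod big_ord0 mul1r.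
  by apply: eq_bigr => j _; rewrite d0.
move=> dN; have [a Ba] := hB 0%N isT.
pose B' j k := B j k.+1.
have hB' k : (k < N)%N -> exists j0, forall j, B' j k = (j == j0).
  by move=> kN; apply: hB.
(* The exponents after the first sign is summed out and the result is expanded in powers of the rest
   of cell [a]: that cell keeps some [i < d a], the others are unchanged. *)
pose d' i j := if j == a then i else d j.
have sumd : (\sum_j d j = d a + \sum_(j | j != a) d j)%N by rewrite (bigD1 a).
have sumd' i : (\sum_j d' i j = i + \sum_(j | j != a) d j)%N.
  rewrite (bigD1 a) //= /d' eqxx; congr addn.
  by apply: eq_bigr => j /negPf->.
have prodd' i (f : J -> nat -> K) :
    \prod_j f j (d' i j) = f a i * \prod_(j | j != a) f j (d j).
  rewrite (bigD1 a) //= /d' eqxx; congr *%R.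
  by apply: eq_bigr => j /negPf->.
have cellS j : (\sum_(k < N.+1) B j k = (j == a) + \sum_(k < N) B' j k)%N.
  by rewrite big_ord_recl Ba.
have -> : \sum_(eps : N.+1.-tuple bool)
     sgn_prod K eps * \prod_j (\sum_(k < N.+1 | B j k) sgn K eps k) ^+ d j
  = \sum_(i < d a) 'C(d a, i)%:R * (1 - (-1) ^+ (d a - i)) *
      \sum_(eps : N.-tuple bool)
        sgn_prod K eps * \prod_j (\sum_(k < N | B' j k) sgn K eps k) ^+ d' i j.
  rewrite big_tuple_cons exchange_big /=.
  under [RHS]eq_bigr do rewrite mulr_sumr.
  rewrite [RHS]exchange_big; apply: eq_bigr => t _ /=.
  pose u j : K := \sum_(k < N | B' j k) sgn K t k.
  have cellE b j : \sum_(k < N.+1 | B j k) sgn K [tuple of b :: t] k =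
      (if j == a then (-1) ^+ b else 0) + u j.
    by rewrite big_mkcond big_ord_recl /= Ba -big_mkcond.
  have factor b :
      \prod_j (\sum_(k < N.+1 | B j k) sgn K [tuple of b :: t] k) ^+ d j =
      ((-1) ^+ b + u a) ^+ d a * \prod_(j | j != a) u j ^+ d j.
    rewrite (bigD1 a) //= cellE eqxx; congr *%R.
    by apply: eq_bigr => j /negPf ja; rewrite cellE ja add0r.
  rewrite (bigD1 true) //= (bigD1 false) //= [X in _ + (_ + X)]big1; last by case.
  rewrite addr0 !factor !sgn_prod_cons expr0 expr1.
  set p := \prod_(j | _) _.
  transitivity (sgn_prod K t * p * ((1 + u a) ^+ d a - (-1 + u a) ^+ d a)).
    by ring.
  rewrite exprD_subN mulr_sumr; apply: eq_bigr => i _.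
  by rewrite (prodd' i (fun j e => u j ^+ e)) -/p; ring.
(* For [d a = 0] both sides vanish: the sum over [i] is empty, and cell [a] contains position 0, so
   its size is positive. *)
case da : (d a) => [|e].
  rewrite big_ord0 ifF //; apply/negbTE/forallPn; exists a.
  by rewrite da cellS eqxx.
have d'N (i : 'I_e.+1) : (\sum_j d' i j <= N)%N.
  by rewrite sumd'; have := ltn_ord i; move: dN; rewrite sumd da; lia.
under [LHS]eq_bigr => i _ do rewrite (IHN _ _ hB' (d'N i)).
(* Only [i = e] survives: for smaller [i] the exponents add up to less than [N], whereas the cell
   sizes add up to [N]. *)
rewrite big_ord_recr /= [X in X + _]big1 ?add0r; last first.
  move=> i _; rewrite ifF ?mulr0 //; apply/negbTE/negP => /forallP d'E.
  suff: (\sum_j d' i j = N)%N.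
    by rewrite sumd'; have := ltn_ord i; move: dN; rewrite sumd da; lia.
  rewrite -[RHS](sum_cells hB'); apply: eq_bigr => j _; exact/eqP/d'E.
have -> : [forall j, d' e j == \sum_(k < N) B' j k]%N =
          [forall j, d j == \sum_(k < N.+1) B j k]%N.
  apply: eq_forallb => j; rewrite cellS /d'.
  by have [->|] := eqVneq j a; rewrite ?da // eqSS.
case: ifP => _; last by rewrite mulr0.
(* The coefficient at [i = e] is [2 * e.+1], which completes both the power of 2 and the factorial
   of [d a]. *)
rewrite (prodd' e (fun _ k => k`!%:R)) [in RHS](bigD1 a) //= da factS binSn subSnn.
by rewrite expr1 natrM exprS; ring.
Qed.

End SignSums.

(** * Expansion of multipolynomials on linear combinations *)

Section Expansion.
Variable K : numFieldType.

Lemma prod_seq_count (J : finType) (s : seq J) (c : J -> K) :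
  \prod_(k <- s) c k = \prod_j c j ^+ count_mem j s.
Proof.
elim: s => [|a s IHs]; first by rewrite big_nil big1.
rewrite big_cons IHs [RHS](eq_bigr (fun j => c j ^+ (a == j) * c j ^+ count_mem j s)).
  rewrite big_split /=; congr *%R.
  rewrite (bigD1 a) //= eqxx expr1 big1 ?mulr1 // => j.
  by rewrite eq_sym => /negPf->.
by move=> j _; rewrite -exprD.
Qed.

Lemma sum_count_mem (J : finType) (s : seq J) :
  (\sum_j count_mem j s = size s)%N.
Proof.
elim: s => [|a s IHs] /=; first by rewrite big1.
rewrite big_split /= IHs (bigD1 a) //= eqxx big1 ?addn0 // => j.
by rewrite eq_sym => /negPf->.
Qed.

(** A substitute for multilinearity: only the substitution of [L j] in slot [j] has to expand, with
    coefficients independent of the other slots. It thus serves both the multilinear map behind a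
    homogeneous polynomial and [P] itself. *)
Lemma expand_coords (E : Type) (F : lmodType K) (T : finType) (u : T -> E) m
    (Phi : ('I_m -> E) -> F) (L : 'I_m -> E) (lam : 'I_m -> T -> K) :
    (forall z j, Phi [eta z with j |-> L j] =
                 \sum_t lam j t *: Phi [eta z with j |-> u t]) ->
  Phi L = \sum_(t : m.-tuple T)
             (\prod_j lam j (tnth t j)) *: Phi (fun j => u (tnth t j)).
Proof.
elim: m Phi L lam => [|m IHm] Phi L lam PhiL.
  rewrite (big_pred1 [tuple]) => [|t]; last by rewrite [t]tuple0; apply/esym/eqP.
  by rewrite big_ord0 scale1r; congr Phi; apply/funext; case.
pose cons e (z : 'I_m -> E) j := oapp z e (unlift ord0 j).
have cons0 e z : cons e z ord0 = e by rewrite /cons unlift_none.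
have consS e z j : cons e z (lift ord0 j) = z j by rewrite /cons liftK.
have consE e (z : 'I_m.+1 -> E) : e = z ord0 ->
    cons e (fun j => z (lift ord0 j)) = z.
  move=> ->; apply/funext => j.
  by case: (unliftP ord0 j) => [i ->|->]; rewrite ?cons0 ?consS.
have -> : Phi L = Phi [eta L with ord0 |-> L ord0].
  by congr Phi; apply/funext => j /=; case: eqP => // ->.
rewrite PhiL big_tuple_cons; apply: eq_bigr => a _.
have -> : ([eta L with ord0 |-> u a] : _ -> _) = cons (u a) (fun j => L (lift ord0 j)).
  by rewrite -[LHS](consE (u a)).
(* The induction hypothesis is applied to [Phi] with slot 0 frozen at [u a]. *)
rewrite (IHm (fun z => Phi (cons (u a) z)) _ (fun j => lam (lift ord0 j))); last first.
  move=> z j.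
  have upd e : cons (u a) [eta z with j |-> e] =
               [eta cons (u a) z with lift ord0 j |-> e] :> (_ -> _).
    apply/funext => i /=; case: (unliftP ord0 i) => [k ->|->].
      by rewrite !consS /= (inj_eq lift_inj).
    by rewrite !cons0.
  by rewrite upd PhiL; apply: eq_bigr => t _; rewrite upd.
rewrite scaler_sumr; apply: eq_bigr => t _.
rewrite scalerA big_ord_recl tnth0; congr (_ * _ *: Phi _).
  by apply: eq_bigr => j _; rewrite tnthS.
rewrite -[RHS](consE (u a)) ?tnth0 //; congr cons.
by apply/funext => j; rewrite tnthS.
Qed.

Lemma linear_comb (E F : lmodType K) (f : E -> F) (T : finType)
    (a : T -> K) (u : T -> E) : linear f ->
  f (\sum_t a t *: u t) = \sum_t a t *: f (u t).
Proof.
move=> flin; pose isL := GRing.isLinear.Build K E F *:%R f flin.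
pose g : {linear E -> F} := HB.pack f isL.
rewrite -[f]/(g : E -> F) linear_sum.
by apply: eq_bigr => t _; rewrite linearZ.
Qed.

(** These are the permutations of ['I_n] written as tuples; the counting form matches the exponents
    in [sum_signs]. *)
Definition balanced n (h : n.-tuple 'I_n) := [forall j, count_mem j h == 1%N].

Lemma balanced_inj n (h : n.-tuple 'I_n) : balanced h -> injective (tnth h).
Proof.
move=> /forallP h1; apply/tuple_uniqP/count_mem_uniq => j.
by rewrite (eqP (h1 j)) -has_pred1 has_count (eqP (h1 j)).
Qed.

(** This cardinal is the normalising constant of polarization; the identity tuple shows that it is
    nonzero. *)
Lemma card_balanced_neq0 n : #|@balanced n|%:R != 0 :> K.
Proof.
rewrite pnatr_eq0 -lt0n; apply/card_gt0P; exists (ord_tuple n).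
rewrite unfold_in; apply/forallP => j.
by rewrite count_uniq_mem ?val_ord_tuple ?enum_uniq // mem_enum.
Qed.

(** The case of singleton cells in [sum_signs]: sign [j] has exponent [count_mem j h], and every
    cell has size 1. *)
Lemma sum_signs_tuple n (h : n.-tuple 'I_n) :
  \sum_(eps : n.-tuple bool) sgn_prod K eps * \prod_(k < n) sgn K eps (tnth h k)
  = if balanced h then 2 ^+ n else 0.
Proof.
have := @sum_signs K _ n (fun j k => k == val j) (fun j => count_mem j h).
have sum1 (j : 'I_n) : (\sum_(k < n) (val k == val j) = 1)%N.
  exact: (@sum_nat_pred1 _ _ j).
under eq_forallb => j do rewrite sum1.
rewrite -/(balanced h) => sumE.
have -> : (if balanced h then 2 ^+ n else 0) =
    if balanced h then 2 ^+ n * \prod_(j < n) (count_mem j h)`!%:R else 0 :> K.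
  case: ifP => // /forallP h1; rewrite big1 ?mulr1 // => j _.
  by rewrite (eqP (h1 j)).
rewrite -sumE; first last.
- by rewrite sum_count_mem size_tuple.
- by move=> k kn; exists (Ordinal kn) => j; rewrite eq_sym.
apply: eq_bigr => eps _; congr *%R.
rewrite -(big_tuple _ _ h xpredT (fun j : 'I_n => sgn K eps j)).
rewrite (prod_seq_count h); apply: eq_bigr => j _.
by rewrite (big_pred1 j).
Qed.

(* The points and scalars on the right do not depend on [Q], so a map of several
   variables can be expanded one variable at a time. *)
Lemma homogeneous_expand (E F : lmodType K) n (Q : E -> F) p
    (y : 'I_p -> E) (c : 'I_p -> K) : homogeneous_polynomial n Q ->
  Q (\sum_j c j *: y j) =
  \sum_(t : n.-tuple 'I_p * n.-tuple bool)
     ((2 ^+ n * #|@balanced n|%:R)^-1 * sgn_prod K t.2 *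
        \prod_(k < n) c (tnth t.1 k)) *:
       Q (\sum_(k < n) sgn K t.2 k *: y (tnth t.1 k)).
Proof.
move=> [A Alin QA].
(* Stated for any family, since it is applied both to the given combination and to signed sums of
   [n] chosen points. *)
have Qexp q (b : 'I_q -> K) (z : 'I_q -> E) : Q (\sum_j b j *: z j) =
    \sum_(f : n.-tuple 'I_q)
      (\prod_(k < n) b (tnth f k)) *: A (fun k => z (tnth f k)).
  rewrite QA (@expand_coords _ _ _ z _ A _ (fun=> b)) // => v j.
  exact: (linear_comb _ _ (Alin v j)).
pose w f := A (fun k => y (tnth f k)).
pose comp (f : n.-tuple 'I_p) (h : n.-tuple 'I_n) :=
  [tuple tnth f (tnth h k) | k < n].
(* Polarization: the signed values of [Q] symmetrize [A] over all reorderings [h] of the slots. *)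
have polar f : \sum_(eps : n.-tuple bool) sgn_prod K eps *:
      Q (\sum_(k < n) sgn K eps k *: y (tnth f k)) =
    2 ^+ n *: \sum_(h | balanced h) w (comp f h).
  under eq_bigr do rewrite Qexp scaler_sumr.
  rewrite exchange_big scaler_sumr [RHS]big_mkcond; apply: eq_bigr => h _ /=.
  under eq_bigr do rewrite scalerA.
  rewrite -scaler_suml sum_signs_tuple.
  have -> : A (fun k => y (tnth f (tnth h k))) = w (comp f h).
    by congr A; apply/funext => k; rewrite tnth_mktuple.
  by case: ifP => // _; rewrite scale0r.
rewrite -(pair_bigA _ (fun f eps => (_ * sgn_prod K eps *
        \prod_(k < n) c (tnth f k)) *:
       Q (\sum_(k < n) sgn K eps k *: y (tnth f k)))) /=.
set N := #|_|%:R.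
transitivity (N^-1 *: \sum_(f : n.-tuple 'I_p) \sum_(h | balanced h)
    (\prod_(k < n) c (tnth f k)) *: w (comp f h)); last first.
  rewrite scaler_sumr; apply: eq_bigr => f _.
  rewrite -scaler_sumr.
  under [RHS]eq_bigr do rewrite mulrAC -scalerA.
  rewrite -scaler_sumr polar !scalerA; congr (_ *: _).
  rewrite invfM [RHS]mulrAC -!mulrA mulrCA; congr *%R.
  by rewrite mulKf // expf_neq0 // pnatr_eq0.
rewrite exchange_big /=.
(* For fixed [h], composition with [h] permutes the tuples [f] and preserves the products of
   coefficients, so each [h] gives back all of [Q]. Averaging over [h] replaces symmetry of [A]. *)
have compE h : balanced h ->
  \sum_(f : n.-tuple 'I_p) (\prod_(k < n) c (tnth f k)) *: w (comp f h) =
  Q (\sum_j c j *: y j).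
  move=> /balanced_inj hinj; rewrite Qexp.
  have [h' hK h'K] := injF_bij hinj.
  rewrite [RHS](reindex_inj (h := comp^~ h)) /=; last first.
    move=> f g fg; apply: eq_from_tnth => k; rewrite -[k]h'K.
    by have := congr1 (fun f => tnth f (h' k)) fg; rewrite !tnth_mktuple.
  apply: eq_bigr => f _; congr (_ *: _).
  rewrite (reindex_inj hinj); apply: eq_bigr => k _.
  by rewrite tnth_mktuple.
rewrite (eq_bigr _ compE) sumr_const -scaler_nat scalerA mulVf ?scale1r //.
exact: card_balanced_neq0.
Qed.

End Expansion.

(** Each slot is expanded by [homogeneous_expand] and the terms are grouped by exponent matrix. The
    family [v] is chosen before [c], so the same coefficients occur in all the sign sums. *)
Lemma multipolynomial_expand (K : numFieldType) (E F : lmodType K) n m p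
    (P : ('I_m -> E) -> F) (y : 'I_p -> E) : symmetric_multipolynomial n P ->
  exists v : 'M['I_n.+1]_(m, p) -> F,
    (forall (b : 'M['I_n.+1]_(m, p)) i, v b != 0 -> (\sum_j b i j = n)%N) /\
    forall c : 'I_m -> 'I_p -> K, P (fun i => \sum_j c i j *: y j) =
      \sum_(b : 'M['I_n.+1]_(m, p)) (\prod_i \prod_j c i j ^+ b i j) *: v b.
Proof.
move=> [Ppoly _].
pose T : finType := (n.-tuple 'I_p * n.-tuple bool)%type.
pose w (t : T) : K := (2 ^+ n * #|@balanced n|%:R)^-1 * sgn_prod K t.2.
pose u (t : T) := \sum_(k < n) sgn K t.2 k *: y (tnth t.1 k).
(* A tuple of length [n] contains [j] at most [n] times, so [inord] keeps the count. *)
pose deg (t : m.-tuple T) : 'M['I_n.+1]_(m, p) :=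
  \matrix_(i, j) inord (count_mem j (tnth t i).1).
have degE t i j : deg t i j = count_mem j (tnth t i).1 :> nat.
  rewrite mxE inordK // ltnS.
  by rewrite -[leqRHS](size_tuple (tnth t i).1) count_size.
exists (fun b => \sum_(t | deg t == b)
          (\prod_i w (tnth t i)) *: P (fun i => u (tnth t i))).
split=> [b i|c].
  (* Unless [b] is the degree matrix of some [t], the sum defining [v b] is empty. *)
  apply: contra_neqP => degb; rewrite big1 // => t /eqP bt; case: degb.
  by rewrite -bt; under eq_bigr do rewrite degE; rewrite sum_count_mem size_tuple.
rewrite (@expand_coords K E F T u m P _
    (fun i t => w t * \prod_(k < n) c i (tnth t.1 k))); last first.
  move=> z i; exact: (homogeneous_expand y (c i) (Ppoly z i)).
rewrite (partition_big deg xpredT) //=; apply: eq_bigr => b _.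
rewrite scaler_sumr; apply: eq_bigr => t /eqP <-.
rewrite scalerA big_split /= mulrC; congr (_ * _ *: _).
apply: eq_bigr => i _.
rewrite -(big_tuple _ _ (tnth t i).1 xpredT (c i)) prod_seq_count.
by apply: eq_bigr => j _; rewrite degE.
Qed.

(** * Partitions into consecutive intervals *)

Section Intervals.

Lemma sum_interval (V : nmodType) N o a (F : nat -> V) : (o + a <= N)%N ->
  \sum_(k < N | (o <= k < o + a)%N) F k = \sum_(l < a) F (o + l)%N.
Proof.
move=> oaN; rewrite -(big_mkord (fun k => o <= k < o + a)%N F).
rewrite -(big_mkord xpredT (fun l => F (o + l)%N)).
have -> : \sum_(0 <= l < a) F (o + l)%N = \sum_(o <= k < o + a) F k.
  by rewrite -[in RHS](add0n o) big_addn add0n addKn; apply: eq_bigr => l _; rewrite addnC.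
by rewrite (big_nat_widenl o 0) // (big_nat_widen 0 (o + a) N).
Qed.

Lemma card_interval N o a : (o + a <= N)%N ->
  (\sum_(k < N) (o <= k < o + a)%N = a)%N.
Proof.
move=> oaN; transitivity (\sum_(k < N | (o <= k < o + a)%N) 1)%N.
  by rewrite [RHS]big_mkcond; apply: eq_bigr => k _; case: ifP.
by rewrite (sum_interval (fun=> 1%N)) // sum1_card card_ord.
Qed.

Variables (p : nat) (a : 'I_p -> nat).
Let psum t := (\sum_(l < p | (l < t)%N) a l)%N.

Lemma psumS (j : 'I_p) : psum j.+1 = (psum j + a j)%N.
Proof.
rewrite /psum (bigD1 j) //= addnC; congr addn; apply: eq_bigl => l.
by rewrite ltnS ltn_neqAle andbC.
Qed.

Lemma psum_mono t t' : (t <= t')%N -> (psum t <= psum t')%N.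
Proof.
move=> tt'; rewrite /psum [leqLHS]big_mkcond [leqRHS]big_mkcond leq_sum // => l _.
by case: ifP => // lt; rewrite (leq_trans lt tt').
Qed.

Lemma psum_full : psum p = (\sum_j a j)%N.
Proof. by apply: eq_bigl => l; rewrite ltn_ord. Qed.

(** The interval containing [r] ends at the first partial sum exceeding [r]. That sum is not the
    zeroth, which is 0, and minimality against [p] bounds its index. *)
Lemma psum_cell r : (r < \sum_j a j)%N ->
  exists j0, forall j : 'I_p, (psum j <= r < psum j + a j)%N = (j == j0).
Proof.
rewrite -psum_full => rp.
have ext : exists t, (r < psum t)%N by exists p.
case: (ex_minnP ext) => [[|t]]; first by rewrite /psum big_pred0.
move=> rt tmin; have tp : (t < p)%N by apply: tmin.
exists (Ordinal tp) => j; rewrite -val_eqE /= -psumS.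
have rt' : (psum t <= r)%N by rewrite leqNgt; apply/negP => /tmin; rewrite ltnn.
case: (ltngtP j t) => [jt|tj|->]; last by rewrite rt' rt.
- by rewrite [(r < _)%N]ltnNge (leq_trans (psum_mono jt) rt') andbF.
- by rewrite leqNgt (leq_trans rt (psum_mono tj)).
Qed.

End Intervals.

(** * The two sign sums of the formula *)

Section SignMonomials.
Variable K : numFieldType.

(** Every row uses the same [m] blocks of [n] signs, so exponents add up along columns and only
    column sums are detected. Column 0 has coefficient 1 and leaves no trace. *)
Lemma sum_signs_columns n m (b : 'I_m -> 'I_m.+1 -> nat) :
    (forall i, \sum_j b i j = n)%N ->
  \sum_(eps : (m * n).-tuple bool) sgn_prod K eps * \prod_i \prod_j
     (oapp (fun j : 'I_m => \sum_(l < n) sgn K eps (j * n + l)%N) 1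
        (unlift ord0 j)) ^+ b i j
  = if [forall j, \sum_i b i (lift ord0 j) == n]%N
    then 2 ^+ (m * n) * n`!%:R ^+ m else 0.
Proof.
move=> rowb; pose B (j : 'I_m) k := (j * n <= k < j * n + n)%N.
have BN (j : 'I_m) : (j * n + n <= m * n)%N by rewrite addnC -mulSn leq_mul2r ltn_ord orbT.
have hB k : (k < m * n)%N -> exists j0, forall j, B j k = (j == j0).
  move=> kN; have n_gt0 : (0 < n)%N by move: kN; case: (n); rewrite ?muln0.
  have km : (k %/ n < m)%N by rewrite ltn_divLR.
  exists (Ordinal km) => j; rewrite -val_eqE /= /B addnC -mulSn.
  by rewrite eqn_leq leq_divRL // -[(k %/ n <= j)%N]ltnS ltn_divLR.
have := @sum_signs K _ _ B (fun j => \sum_i b i (lift ord0 j))%N hB.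
have -> : [forall j, \sum_i b i (lift ord0 j) == \sum_(k < m * n) B j k]%N =
          [forall j, \sum_i b i (lift ord0 j) == n]%N.
  by apply: eq_forallb => j; rewrite card_interval.
(* Only an inequality, because column 0 is left out. *)
have rows : (\sum_(j < m) \sum_i b i (lift ord0 j) <= m * n)%N.
  rewrite exchange_big /= -[in leqRHS](card_ord m) -sum_nat_const leq_sum // => i _.
  by rewrite -[leqRHS](rowb i) big_ord_recl leq_addl.
move=> /(_ rows) sumE; transitivity
    (if [forall j, \sum_i b i (lift ord0 j) == n]%N
    then 2 ^+ (m * n) * \prod_(j < m) (\sum_i b i (lift ord0 j))`!%:R else 0 : K).
  rewrite -sumE; apply: eq_bigr => eps _; congr *%R.
  rewrite exchange_big /=; under eq_bigr do rewrite prodrXr.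
  rewrite big_ord_recl unlift_none /= expr1n mul1r; apply: eq_bigr => j _.
  by rewrite liftK /= sum_interval.
case: ifP => // /forallP colb; congr *%R.
under eq_bigr => j _ do rewrite (eqP (colb j)).
by rewrite prodr_const card_ord.
Qed.

(** Here the cells are indexed by pairs: block [i] of [n] signs is cut into pieces of lengths
    [a i j]. Each entry has its own cell, so every exponent is detected. *)
Lemma sum_signs_rows n m p (b a : 'I_m -> 'I_p -> nat) :
    (forall i, \sum_j b i j = n)%N -> (forall i, \sum_j a i j = n)%N ->
  \sum_(eps : (m * n).-tuple bool) sgn_prod K eps * \prod_i \prod_j
     (\sum_(k < a i j)
        sgn K eps (i * n + \sum_(l < p | (l < j)%N) a i l + k)%N) ^+ b i j
  = if [forall i, forall j, b i j == a i j]
    then 2 ^+ (m * n) * (\prod_i \prod_j (a i j)`!)%N%:R else 0.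
Proof.
move=> rowb rowa.
pose o i (j : 'I_p) := (\sum_(l < p | (l < j)%N) a i l)%N.
have on i j : (o i j + a i j <= n)%N.
  by rewrite -psumS -(rowa i) -psum_full psum_mono.
pose B (ij : 'I_m * 'I_p) k :=
  (ij.1 * n + o ij.1 ij.2 <= k < ij.1 * n + o ij.1 ij.2 + a ij.1 ij.2)%N.
have BN (i : 'I_m) (j : 'I_p) : (i * n + o i j + a i j <= m * n)%N.
  rewrite -addnA (leq_trans (leq_add (leqnn _) (on i j))) //.
  by rewrite addnC -mulSn leq_mul2r ltn_ord orbT.
have hB k : (k < m * n)%N -> exists ij0, forall ij, B ij k = (ij == ij0).
  move=> kN; have n_gt0 : (0 < n)%N by move: kN; case: (n); rewrite ?muln0.
  have km : (k %/ n < m)%N by rewrite ltn_divLR.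
  have := ltn_pmod k n_gt0; have := divn_eq k n.
  set i0 := Ordinal km; rewrite -[(k %/ n)%N]/(val i0) => kE.
  move: (k %% n)%N kE => r -> rn.
  (* The quotient of the position by [n] gives the block, and the remainder [r] gives the piece
     inside it. *)
  have [j0 j0E] : exists j0, forall j, (o i0 j <= r < o i0 j + a i0 j)%N = (j == j0).
    by apply: psum_cell; rewrite rowa.
  exists (i0, j0) => -[i j]; rewrite xpair_eqE /B /= -addnA.
  have [->|] := eqVneq i i0; first by rewrite leq_add2l ltn_add2l j0E.
  rewrite -val_eqE neq_ltn => /orP ii0; apply/negbTE/negP => /andP[h1 h2].
  have := on i j; case: ii0 => ii0; have := leq_mul ii0 (leqnn n);
    by rewrite mulSn /=; lia.
have := @sum_signs K _ _ B (fun ij => b ij.1 ij.2) hB.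
have cell (ij : 'I_m * 'I_p) : (\sum_(k < m * n) B ij k = a ij.1 ij.2)%N.
  exact: card_interval.
have -> : [forall ij, b ij.1 ij.2 == \sum_(k < m * n) B ij k]%N =
          [forall i, forall j, b i j == a i j].
  apply/forallP/forallP => [h i|h [i j]].
    by apply/forallP => j; have := h (i, j); rewrite cell.
  by rewrite cell; apply: (forallP (h i)).
have sumb : (\sum_(ij : 'I_m * 'I_p) b ij.1 ij.2 <= m * n)%N.
  rewrite -(pair_bigA _ b) /= (eq_bigr _ (fun i _ => rowb i)).
  by rewrite sum_nat_const card_ord.
move=> /(_ sumb) sumE; transitivity
    (if [forall i, forall j, b i j == a i j]
    then 2 ^+ (m * n) * \prod_(ij : 'I_m * 'I_p) (b ij.1 ij.2)`!%:R else 0 : K).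
  rewrite -sumE; apply: eq_bigr => eps _; congr *%R.
  rewrite pair_bigA; apply: eq_bigr => -[i j] _.
  by rewrite sum_interval //.
case: ifP => // /forallP ba; congr *%R.
rewrite -(pair_bigA _ (fun i j => (b i j)`!%:R)) natr_prod.
apply: eq_bigr => i _; rewrite natr_prod; apply: eq_bigr => j _ /=.
by rewrite (eqP (forallP (ba i) j)).
Qed.

End SignMonomials.

(** * Bounded exponent matrices and permutations *)

Section IndexMatrices.
Variables n m : nat.

(** Matrices in [index_matrices] have entries at most [n], so they all come from this finite
    type. *)
Definition nat_mx (b : 'M['I_n.+1]_(m, m.+1)) : 'M[nat]_(m, m.+1) :=
  map_mx (@nat_of_ord n.+1) b.

Lemma nat_mx_inj : injective nat_mx.
Proof.
move=> b c /matrixP bc; apply/matrixP => i j; apply: val_inj.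
by have := bc i j; rewrite !mxE.
Qed.

Lemma index_matrices_row alpha i : index_matrices n m alpha ->
  (\sum_j alpha i j = n)%N.
Proof. by case=> a0 ar _; rewrite big_ord_recl a0 ar. Qed.

Lemma nat_mx_surj alpha : index_matrices n m alpha ->
  exists b, nat_mx b = alpha.
Proof.
move=> Malpha; exists (map_mx inord alpha); apply/matrixP => i j.
rewrite !mxE inordK // ltnS -[leqRHS](index_matrices_row i Malpha).
by rewrite (bigD1 j) //= leq_addr.
Qed.

(** Turns the finitely supported sum in [remainder] into an ordinary sum over a finite type. *)
Lemma fsum_nat_mx (V : nmodType) (A : set 'M[nat]_(m, m.+1))
    (f : 'M[nat]_(m, m.+1) -> V) : (A `<=` index_matrices n m)%classic ->
  \sum_(alpha \in A) f alpha = \sum_(b | nat_mx b \in A) f (nat_mx b).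
Proof.
move=> AM.
rewrite (@reindex_fsbig _ _ _ _ _ nat_mx [set` [pred b | nat_mx b \in A]]%classic).
  by rewrite -(@bigfs _ _ _ _ (index_enum _)) ?index_enum_uniq // => b _; rewrite mem_index_enum.
split=> [b /=|b c _ _|alpha Aalpha]; first by rewrite inE.
  exact: nat_mx_inj.
have [b bE] := nat_mx_surj (AM _ Aalpha); exists b; last exact: bE.
by suff: nat_mx b \in A by []; rewrite bE inE.
Qed.

(** This is [n] times a permutation matrix, preceded by the zero column. *)
Definition perm_index (s : 'S_m) : 'M['I_n.+1]_(m, m.+1) :=
  \matrix_(i, j) if unlift ord0 j is Some k
                 then if i == s k then ord_max else ord0 else ord0.

Lemma perm_index0 s i : perm_index s i ord0 = 0%N :> nat.
Proof. by rewrite mxE unlift_none. Qed.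

Lemma perm_indexE s i j :
  perm_index s i (lift ord0 j) = (if i == s j then n else 0)%N :> nat.
Proof. by rewrite mxE liftK; case: ifP. Qed.

Lemma perm_index_inj : (0 < n)%N -> injective perm_index.
Proof.
move=> n_gt0 s t st; apply/permP => j; apply/eqP.
have := perm_indexE t (s j) j; rewrite -st perm_indexE eqxx.
by case: ifP => // _ n0; rewrite n0 in n_gt0.
Qed.

(** Let [f j] be a row where column [j] has the entry [n]. Two columns cannot share that row, whose
    sum is [n > 0], so [f] is a permutation; the column sums make all other entries 0. *)
Lemma concentratedP (b : 'M['I_n.+1]_(m, m.+1)) : (0 < n)%N ->
  concentrated_matrices n m (nat_mx b) <-> exists s, b = perm_index s.
Proof.
move=> n_gt0; split=> [[[b0 br bc] bn]|[s ->]]; last first.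
  split=> [|j]; last by exists (s j); rewrite mxE perm_indexE eqxx.
  split=> [i|i|j]; first by rewrite mxE perm_index0.
    rewrite (bigD1 (s^-1 i)%g) //= mxE perm_indexE permKV eqxx big1 ?addn0 // => j.
    by rewrite mxE perm_indexE; case: (i =P s j) => [->|]; rewrite ?permK ?eqxx.
  rewrite (bigD1 (s j)) //= mxE perm_indexE eqxx big1 ?addn0 // => i.
  by rewrite mxE perm_indexE => /negPf->.
have bn' j : exists i, nat_mx b i (lift ord0 j) == n.
  by have [i bin] := bn j; exists i; apply/eqP.
pose f j := xchoose (bn' j).
have fE j : nat_mx b (f j) (lift ord0 j) = n := eqP (xchooseP (bn' j)).
have finj : injective f.
  move=> j k fjk; apply/eqP/negPn/negP => jk.
  have := br (f j); rewrite (bigD1 j) //= (bigD1 k) 1?eq_sym //= fE fjk fE.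
  by move: n_gt0; lia.
exists (perm finj); apply/matrixP => i j; apply: val_inj => /=.
case: (unliftP ord0 j) => [k ->|->]; last first.
  by rewrite perm_index0; have := b0 i; rewrite mxE.
rewrite perm_indexE permE; case: eqP => [->|/eqP ifk].
  by rewrite -[RHS](fE k) mxE.
have := bc k; rewrite (bigD1 (f k)) //= fE => /eqP.
rewrite -[X in _ == X]addn0 eqn_add2l sum_nat_eq0 => /forallP/(_ i).
by rewrite ifk mxE => /eqP.
Qed.

Lemma sum_concentrated (V : nmodType) (v : 'M['I_n.+1]_(m, m.+1) -> V) :
    (0 < n)%N ->
  \sum_(b | nat_mx b \in concentrated_matrices n m) v b =
  \sum_(s : 'S_m) v (perm_index s).
Proof.
move=> n_gt0; rewrite -(big_imset _ (in2W (perm_index_inj n_gt0))) /=.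
apply: eq_bigl => b; apply/idP/imsetP => [|[s _ ->]].
  by rewrite inE concentratedP // => -[s ->]; exists s.
by rewrite inE concentratedP //; exists s.
Qed.

End IndexMatrices.

(** * Coefficient extraction and the polarization formula *)

Section Polarization.
Variables (K : numFieldType) (E F : lmodType K) (n m : nat).
Variables (P : ('I_m -> E) -> F) (x0 : E) (x : 'I_m -> E).
Hypothesis n_gt0 : (0 < n)%N.
Hypothesis P_poly : symmetric_multipolynomial n P.

Let y (j : 'I_m.+1) := oapp x x0 (unlift ord0 j).

Let comb (c : 'I_m.+1 -> K) :
  \sum_j c j *: y j = c ord0 *: x0 + \sum_j c (lift ord0 j) *: x j.
Proof.
rewrite big_ord_recl /y unlift_none; congr (_ + _).
by apply: eq_bigr => j _; rewrite liftK.
Qed.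

Variable v : 'M['I_n.+1]_(m, m.+1) -> F.
Hypothesis v_row :
  forall (b : 'M['I_n.+1]_(m, m.+1)) i, v b != 0 -> (\sum_j b i j = n)%N.
Hypothesis P_expand : forall c : 'I_m -> 'I_m.+1 -> K,
  P (fun i => \sum_j c i j *: y j) =
  \sum_(b : 'M['I_n.+1]_(m, m.+1)) (\prod_i \prod_j c i j ^+ b i j) *: v b.

(** The expansion is evaluated at the permutation matrix of [s] as coefficients. The left side is
    [P x] by symmetry, and on the right only [perm_index n s] contributes. *)
Lemma coef_perm_index s : v (perm_index n s) = P x.
Proof.
pose c i (j : 'I_m.+1) : K := oapp (fun k => (i == s k)%:R) 0 (unlift ord0 j).
have := P_expand c.
have -> : (fun i => \sum_j c i j *: y j) = (fun i => x (s^-1 i)%g).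
  apply/funext => i; rewrite comb /c unlift_none scale0r add0r.
  rewrite (bigD1 (s^-1 i)%g) //= liftK /= permKV eqxx scale1r big1 ?addr0 // => j.
  rewrite liftK /=; case: (i =P s j) => [->|_]; first by rewrite permK eqxx.
  by rewrite scale0r.
rewrite P_poly.2 => ->; rewrite (bigD1 (perm_index n s)) //=.
rewrite [X in _ = _ + X]big1 ?addr0 => [|b bs].
  (* Where the coefficient is 0 the exponent is 0 too, and [0 ^+ 0] is 1. *)
  rewrite big1 ?scale1r // => i _; rewrite big1 // => j _.
  case: (unliftP ord0 j) => [k ->|->]; last by rewrite perm_index0 expr0.
  rewrite perm_indexE /c liftK /=; case: eqP => // _; exact: expr1n.
have [->|vb] := eqVneq (v b) 0; first by rewrite scaler0.
suff [i [j [cij bij]]] : exists i j, c i j = 0 /\ b i j != 0%N :> nat.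
  rewrite (bigD1 i) //= (bigD1 j) //= cij expr0n (negPf bij).
  by rewrite !mul0r scale0r.
(* Otherwise [b] is supported where [c] is nonzero, at one entry per row, which the row sum forces
   to be [n]. *)
apply: contrapT => nex; case/negP: bs; apply/eqP/matrixP => i j.
have b0 k : c i k = 0 -> b i k = 0%N :> nat.
  by move=> cik; apply: contrapT => /eqP bik; apply: nex; exists i, k.
have b0s k : i != s k -> b i (lift ord0 k) = 0%N :> nat.
  by move=> /negPf isk; apply: b0; rewrite /c liftK /= isk.
apply: val_inj => /=; case: (unliftP ord0 j) => [k ->|->]; last first.
  by rewrite perm_index0 b0 // /c unlift_none.
rewrite perm_indexE; case: eqP => [isk|/eqP]; last exact: b0s.
rewrite -[RHS](v_row i vb) big_ord_recl (b0 ord0) ?add0n; last by rewrite /c unlift_none.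
rewrite (bigD1 k) //= big1 ?addn0 // => l lk; apply: b0s.
by rewrite isk (inj_eq perm_inj) eq_sym.
Qed.

(** All slots hold the same point, so [sum_signs_columns] selects the [b] whose columns after column
    0 sum to [n]. *)
Lemma diagonal_sum :
  \sum_(eps : (m * n).-tuple bool) sgn_prod K eps *:
     P (fun=> x0 + \sum_(j < m) (\sum_(l < n) sgn K eps (j * n + l)%N) *: x j)
  = (2 ^+ (m * n) * n`!%:R ^+ m) *:
      \sum_(b | nat_mx b \in index_matrices n m) v b.
Proof.
pose c eps (j : 'I_m.+1) := oapp (fun j : 'I_m =>
  \sum_(l < n) @sgn K (m * n) eps (j * n + l)%N) 1 (unlift ord0 j).
have PE eps : P (fun=> x0 +
      \sum_(j < m) (\sum_(l < n) @sgn K (m * n) eps (j * n + l)%N) *: x j) =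
    \sum_(b : 'M['I_n.+1]_(m, m.+1)) (\prod_i \prod_j c eps j ^+ b i j) *: v b.
  rewrite -P_expand; congr P; apply/funext => i.
  rewrite comb /c unlift_none scale1r; congr (_ + _).
  by apply: eq_bigr => j _; rewrite liftK.
under eq_bigr do rewrite PE scaler_sumr.
rewrite exchange_big /= scaler_sumr [RHS]big_mkcond; apply: eq_bigr => b _.
under eq_bigr do rewrite scalerA.
rewrite -scaler_suml.
have [->|vb] := eqVneq (v b) 0; first by rewrite !scaler0 if_same.
rewrite sum_signs_columns => [|i]; last exact: v_row.
have -> : [forall j, \sum_i b i (lift ord0 j) == n]%N =
          (nat_mx b \in index_matrices n m).
  apply/forallP/idP => [bc|]; last first.
    rewrite inE => -[_ _ bc] j; apply/eqP; rewrite -[RHS](bc j).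
    by apply: eq_bigr => i _; rewrite mxE.
  (* The rows total [m * n] and columns 1 to [m] already account for it, so column 0 vanishes. This
     is why [x0] disappears from the result. *)
  have b0 : (\sum_i b i ord0 = 0)%N.
    have := @exchange_big _ _ addn _ _ (index_enum 'I_m) (index_enum 'I_m.+1)
      xpredT xpredT (fun i j => b i j : nat).
    under eq_bigr => i _ do rewrite (v_row i vb).
    rewrite big_ord_recl.
    under [X in _ = (_ + X)%N -> _]eq_bigr => j _ do rewrite (eqP (bc j)).
    by rewrite !sum_nat_const !card_ord -{1}[(m * n)%N]add0n => /addIn.
  have {}b0 i : b i ord0 = 0%N :> nat.
    by apply/eqP; move/eqP: b0; rewrite sum_nat_eq0 => /forallP/(_ i).
  rewrite inE; split=> [i|i|j]; first by rewrite mxE.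
    rewrite -[RHS](v_row i vb) big_ord_recl b0 add0n.
    by apply: eq_bigr => j _; rewrite mxE.
  by rewrite -[RHS](eqP (bc j)); apply: eq_bigr => i _; rewrite mxE.
by case: ifP => // _; rewrite scale0r.
Qed.

(** For each matrix of the sum, [sum_signs_rows] selects that matrix alone, and its product of
    factorials cancels the denominator. *)
Lemma remainder_coef : remainder n P x =
  2 ^+ (m * n) *: \sum_(b | nat_mx b \in
    (index_matrices n m `\` concentrated_matrices n m)%classic) v b.
Proof.
rewrite /remainder (@fsum_nat_mx n) => [|alpha []//].
rewrite scaler_sumr; apply: eq_bigr => a; rewrite inE => -[Ma _].
(* Column 0 is included: it is zero in [nat_mx a], so its block sum is empty and [x0] gets
   coefficient 0. *)
pose c eps i (j : 'I_m.+1) := \sum_(k < nat_mx a i j)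
  @sgn K (m * n) eps (i * n + \sum_(l < m.+1 | (l < j)%N) nat_mx a i l + k)%N.
have PE eps : P (fun i => \sum_(j < m) block_sum K (nat_mx a) eps i j *: x j) =
    \sum_(b : 'M['I_n.+1]_(m, m.+1)) (\prod_i \prod_j c eps i j ^+ b i j) *: v b.
  rewrite -P_expand; congr P; apply/funext => i.
  by rewrite comb /c; case: Ma => -> _ _; rewrite big_ord0 scale0r add0r.
under eq_bigr do rewrite PE scaler_sumr.
have rowa i : (\sum_j nat_mx a i j = n)%N by apply: index_matrices_row.
have signs b : v b != 0 ->
    \sum_(eps : (m * n).-tuple bool) sgn_prod K eps *
       \prod_i \prod_j c eps i j ^+ b i j =
    if b == a then 2 ^+ (m * n) * (\prod_i row_fact (nat_mx a) i)%N%:R else 0.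
  move=> vb; rewrite sum_signs_rows // => [|i]; last exact: v_row.
  suff -> : [forall i, forall j, b i j == nat_mx a i j :> nat] = (b == a) by [].
  apply/forallP/eqP => [ba|-> i]; last by apply/forallP => j; rewrite mxE.
  apply/matrixP => i j; apply: val_inj.
  by have := forallP (ba i) j; rewrite mxE => /eqP.
have fact_neq0 : (\prod_i row_fact (nat_mx a) i)%N%:R != 0 :> K.
  rewrite pnatr_eq0 -lt0n prodn_gt0 // => i.
  by rewrite prodn_gt0 // => j; apply: fact_gt0.
rewrite exchange_big /= (bigD1 a) //= [X in _ + X]big1 ?addr0 => [|b ba];
  under eq_bigr do rewrite scalerA mulrAC;
  rewrite -scaler_suml -mulr_suml.
  have [->|va] := eqVneq (v a) 0; first by rewrite !scaler0.
  by rewrite signs // eqxx mulfK.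
have [->|vb] := eqVneq (v b) 0; first by rewrite scaler0.
by rewrite signs // (negPf ba) mul0r scale0r.
Qed.

End Polarization.

(** The algebraic identity over any [numFieldType], which covers the real and complex cases
    together. *)
Lemma polarization_remainder (K : numFieldType) (E F : lmodType K) n m
    (P : ('I_m -> E) -> F) (x0 : E) (x : 'I_m -> E) :
  (0 < n)%N -> symmetric_multipolynomial n P ->
  P x =
    (m`!%:R * (n`!%:R * 2 ^+ n) ^+ m)^-1 *:
      (\sum_(eps : (m * n).-tuple bool)
         sgn_prod K eps *:
           P (fun=> x0 + \sum_(j < m)
                     (\sum_(l < n) sgn K eps (j * n + l)%N) *: x j))
    - (m`!%:R * 2 ^+ (m * n))^-1 *: remainder n P x.
Proof.
move=> n_gt0 P_poly.
have [v [v_row P_expand]] :=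
  multipolynomial_expand (fun j => oapp x x0 (unlift ord0 j)) P_poly.
rewrite (diagonal_sum v_row P_expand) (remainder_coef v_row P_expand) !scalerA.
have fact_neq0 k : k`!%:R != 0 :> K by rewrite pnatr_eq0 -lt0n fact_gt0.
have pow_neq0 k : 2 ^+ k != 0 :> K by rewrite expf_neq0 // pnatr_eq0.
(* Both prefactors reduce to the inverse of [m!], so the two sums over matrices can be subtracted
   directly. *)
have -> : (m`!%:R * (n`!%:R * 2 ^+ n) ^+ m)^-1 * (2 ^+ (m * n) * n`!%:R ^+ m) =
          m`!%:R^-1 :> K.
  rewrite exprMn -exprM [(n * m)%N]mulnC [_ ^+ m * _]mulrC invfM mulfVK //.
  by rewrite mulf_eq0 negb_or pow_neq0 expf_neq0.
have -> : (m`!%:R * 2 ^+ (m * n))^-1 * 2 ^+ (m * n) = m`!%:R^-1 :> K.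
  by rewrite invfM mulfVK.
rewrite -scalerBr (bigID (fun b => nat_mx b \in concentrated_matrices n m)) /=.
rewrite [X in _ *: (X + _ - _)](eq_bigl
  (fun b => nat_mx b \in concentrated_matrices n m)); last first.
  move=> b; apply/andP/idP => [[]//|Cb]; split=> //.
  by move: Cb; rewrite !inE => -[].
(* The concentrated part consists of [m!] terms, one for each permutation and each equal to [P x];
   the rest cancels against the remainder. *)
rewrite sum_concentrated //
  (eq_bigr _ (fun s _ => coef_perm_index P_poly v_row P_expand s)).
rewrite [X in _ *: (_ + X - _)](eq_bigl (fun b => nat_mx b \in
    (index_matrices n m `\` concentrated_matrices n m)%classic)); last first.
  by move=> b; rewrite in_setD.
by rewrite addrK sumr_const card_Sn -scaler_nat scalerA mulVf ?scale1r.
Qed.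

Theorem theorem3p2 (R : realType) (k : scalar_kind)
    (E F : completeNormedModType (scalar_field R k))
    (m n : nat) (m_gt0 : (0 < m)%N) (n_gt0 : (0 < n)%N)
    (P : ('I_m -> E) -> F) (P_poly : symmetric_multipolynomial n P)
    (x0 : E) (x : 'I_m -> E) :
  P x =
    (m`!%:R * (n`!%:R * 2 ^+ n) ^+ m)^-1 *:
      (\sum_(eps : (m * n).-tuple bool)
         sgn_prod (scalar_field R k) eps *:
           P (fun=> x0 + \sum_(j < m)
                     (\sum_(l < n) sgn (scalar_field R k) eps (j * n + l)%N)
                       *: x j))
    - (m`!%:R * 2 ^+ (m * n))^-1 *: remainder n P x.
Proof.
exact: polarization_remainder.
Qed.
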